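(* Let $\{\varphi_i\}_{i=1}^N$ be a unit norm tight frame in $\mathbb{R}^M$ and assume $\sum_{i=1}^N\varphi_i=0$. Then for any $x,y\in\mathbb{R}^M$ with $\|x\|=\|y\|=1$, $$4N\Big(1-\frac1M\Big)\le\sum_{i=1}^N\|x-\varphi_i\|^2\|y-\varphi_i\|^2\le 4N\Big(1+\frac1M\Big).$$
   Context: A family $\{\varphi_i\}_{i=1}^N$ in $\mathbb{R}^M$ is a tight frame if there is a constant $A>0$ with $\sum_{i=1}^N|\langle x,\varphi_i\rangle|^2=A\|x\|^2$ for all $x\in\mathbb{R}^M$; it is unit norm if $\|\varphi_i\|=1$ for all $i$. *)

(* Defs.v *)
From HB Require Import structures.
From mathcomp Require Import all_boot all_order all_algebra.
From mathcomp Require Import reals.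

Set Implicit Arguments.
Unset Strict Implicit.
Unset Printing Implicit Defensive.

Import Order.TTheory GRing.Theory Num.Theory.
Local Open Scope ring_scope.

(* The library's dot product [dotmx] is only available over a
   numClosedFieldType, and MathComp-Analysis equips 'rV[R]_M with the
   supremum norm, so the Euclidean structure of R^M is defined here. *)
Definition dotprod (R : realType) (M : nat) (x y : 'rV[R]_M) : R :=
  \sum_(j < M) x 0 j * y 0 j.

Definition enorm (R : realType) (M : nat) (x : 'rV[R]_M) : R :=
  Num.sqrt (dotprod x x).

Definition tight_frame (R : realType) (M N : nat)
    (phi : 'I_N -> 'rV[R]_M) : Prop :=
  exists2 A : R, 0 < A &
    forall x : 'rV[R]_M,
      \sum_(i < N) `|dotprod x (phi i)| ^+ 2 = A * enorm x ^+ 2.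

Definition unit_norm (R : realType) (M N : nat)
    (phi : 'I_N -> 'rV[R]_M) : Prop :=
  forall i : 'I_N, enorm (phi i) = 1.

(* Main.v *)
(** Expanding the squared distances gives
    [|x - phi_i|^2 |y - phi_i|^2 = 4 (1 - <x,phi_i>) (1 - <y,phi_i>)].
    The linear terms vanish after summation because the frame vectors sum to
    zero, and polarizing the tight frame identity turns the sum into
    [4 (N + A <x,y>)].  Testing the frame on the standard basis gives
    [A M = N], and [-1 <= <x,y> <= 1] concludes. *)
Require Import Defs.
From HB Require Import structures.
From mathcomp Require Import all_boot all_order all_algebra.
From mathcomp Require Import reals.
From mathcomp Require Import ring lra.

Set Implicit Arguments.
Unset Strict Implicit.
Unset Printing Implicit Defensive.

Import Order.TTheory GRing.Theory Num.Theory.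
Local Open Scope ring_scope.

Lemma dotprodC (R : realType) (M : nat) (x y : 'rV[R]_M) :
  dotprod x y = dotprod y x.
Proof. by apply: eq_bigr => j _; rewrite mulrC. Qed.

Lemma dotprodDl (R : realType) (M : nat) (x y z : 'rV[R]_M) :
  dotprod (x + y) z = dotprod x z + dotprod y z.
Proof. by rewrite -big_split; apply: eq_bigr => j _; rewrite mxE mulrDl. Qed.

Lemma dotprodNl (R : realType) (M : nat) (x z : 'rV[R]_M) :
  dotprod (- x) z = - dotprod x z.
Proof. by rewrite -sumrN; apply: eq_bigr => j _; rewrite mxE mulNr. Qed.

Lemma dotprod_sumr (R : realType) (M N : nat) (x : 'rV[R]_M)
    (phi : 'I_N -> 'rV[R]_M) :
  dotprod x (\sum_(i < N) phi i) = \sum_(i < N) dotprod x (phi i).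
Proof.
rewrite exchange_big; apply: eq_bigr => j _ /=.
by rewrite summxE mulr_sumr.
Qed.

Lemma dotprod_deltal (R : realType) (M : nat) (j : 'I_M) (y : 'rV[R]_M) :
  dotprod (delta_mx 0 j) y = y 0 j.
Proof.
rewrite /dotprod (bigD1 j) //= big1 => [|k /negPf kj].
  by rewrite mxE !eqxx mul1r addr0.
by rewrite mxE kj andbF mul0r.
Qed.

Lemma dotprod_ge0 (R : realType) (M : nat) (x : 'rV[R]_M) : 0 <= dotprod x x.
Proof. by apply: sumr_ge0 => j _; rewrite -expr2 sqr_ge0. Qed.

Lemma enorm_sqr (R : realType) (M : nat) (x : 'rV[R]_M) :
  enorm x ^+ 2 = dotprod x x.
Proof. by rewrite sqr_sqrtr ?dotprod_ge0. Qed.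

Lemma enormD_sqr (R : realType) (M : nat) (x y : 'rV[R]_M) :
  enorm (x + y) ^+ 2 = enorm x ^+ 2 + 2 * dotprod x y + enorm y ^+ 2.
Proof.
rewrite !enorm_sqr dotprodDl !(dotprodC _ (x + y)) !dotprodDl (dotprodC y x).
by ring.
Qed.

Lemma enormB_sqr (R : realType) (M : nat) (x y : 'rV[R]_M) :
  enorm (x - y) ^+ 2 = enorm x ^+ 2 - 2 * dotprod x y + enorm y ^+ 2.
Proof.
rewrite enormD_sqr [enorm (- y) ^+ 2]enorm_sqr dotprodNl !(dotprodC _ (- y)).
by rewrite !dotprodNl (dotprodC y x) enorm_sqr [enorm y ^+ 2]enorm_sqr; ring.
Qed.

(** Cauchy-Schwarz for unit vectors: here the squares of [enorm (x + y)] and [enorm (x - y)] equal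
    [2 + 2 * dotprod x y] and [2 - 2 * dotprod x y], and both are nonnegative. *)
Lemma dotprod_unit_bounds (R : realType) (M : nat) (x y : 'rV[R]_M) :
  enorm x = 1 -> enorm y = 1 -> -1 <= dotprod x y <= 1.
Proof.
move=> x1 y1.
have := sqr_ge0 (enorm (x + y)); have := sqr_ge0 (enorm (x - y)).
by rewrite enormB_sqr enormD_sqr x1 y1; lra.
Qed.

(** Expanding the frame identity at [x + y] and subtracting the identities at [x] and at [y] leaves
    twice the cross terms on each side. *)
Lemma frame_polarization (R : realType) (M N : nat)
    (phi : 'I_N -> 'rV[R]_M) (A : R)
    (frameA : forall z : 'rV[R]_M,
       \sum_(i < N) `|dotprod z (phi i)| ^+ 2 = A * enorm z ^+ 2)
    (x y : 'rV[R]_M) :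
  \sum_(i < N) dotprod x (phi i) * dotprod y (phi i) = A * dotprod x y.
Proof.
have sqE z : \sum_(i < N) dotprod z (phi i) ^+ 2 = A * enorm z ^+ 2.
  by rewrite -frameA; apply: eq_bigr => i _; rewrite real_normK ?num_real.
have := sqE (x + y); rewrite enormD_sqr.
under eq_bigr => i _ do rewrite dotprodDl sqrrD -mulr_natl.
rewrite !big_split /= !sqE -mulr_sumr.
by lra.
Qed.

(** Double counting of the squares of all coordinates of the frame vectors: each of the [M] basis
    vectors contributes [A], and each of the [N] unit vectors contributes 1. *)
Lemma unit_norm_frame_constant (R : realType) (M N : nat)
    (phi : 'I_N -> 'rV[R]_M) (A : R)
    (frameA : forall z : 'rV[R]_M,
       \sum_(i < N) `|dotprod z (phi i)| ^+ 2 = A * enorm z ^+ 2) :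
  unit_norm phi -> A * M%:R = N%:R.
Proof.
move=> phi1.
have -> : A * M%:R =
    \sum_(j < M) \sum_(i < N) dotprod (delta_mx 0 j) (phi i)
                              * dotprod (delta_mx 0 j) (phi i).
  (* Polarization with both arguments equal to the [j]-th basis vector gives [A] times the [(j, j)]
     entry 1. *)
  under eq_bigr => j _ do
    rewrite (frame_polarization frameA) dotprod_deltal mxE !eqxx mulr1.
  by rewrite sumr_const card_ord mulr_natr.
rewrite exchange_big /=.
(* With the sums exchanged, the inner sum over coordinates is the squared norm of [phi i]. *)
under eq_bigr => i _.
  under eq_bigr => j _ do rewrite dotprod_deltal.
  rewrite -/(dotprod (phi i) (phi i)) -enorm_sqr phi1 expr1n.
  over.
by rewrite sumr_const card_ord.
Qed.

Theorem theorem6p8 (R : realType) (M N : nat) (phi : 'I_N -> 'rV[R]_M)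
    (phi_tight : tight_frame phi) (phi_unit : unit_norm phi)
    (phi_sum0 : \sum_(i < N) phi i = 0)
    (x y : 'rV[R]_M) (x_unit : enorm x = 1) (y_unit : enorm y = 1) :
  4 * N%:R * (1 - 1 / M%:R)
    <= \sum_(i < N) enorm (x - phi i) ^+ 2 * enorm (y - phi i) ^+ 2
    <= 4 * N%:R * (1 + 1 / M%:R).
Proof.
have [A A_gt0 frameA] := phi_tight.
(* In dimension 0 every norm is 0, which contradicts [enorm x = 1]. Nonvanishing of [M%:R] lets
   [field] cancel the quotients [1 / M%:R] below. *)
have M_neq0 : M%:R != 0 :> R.
  rewrite pnatr_eq0; apply/eqP => M0; subst M.
  by have := enorm_sqr x; rewrite x_unit /dotprod big_ord0; lra.
have sum_dot0 z : \sum_(i < N) dotprod z (phi i) = 0.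
  rewrite -dotprod_sumr phi_sum0 /dotprod big1 // => j _.
  by rewrite mxE mulr0.
have -> : \sum_(i < N) enorm (x - phi i) ^+ 2 * enorm (y - phi i) ^+ 2
        = 4 * (N%:R + A * dotprod x y).
  transitivity (\sum_(i < N) (4 * (1 - dotprod x (phi i) - dotprod y (phi i)
                         + dotprod x (phi i) * dotprod y (phi i)))).
    apply: eq_bigr => i _.
    by rewrite !enormB_sqr x_unit y_unit phi_unit; ring.
  rewrite -mulr_sumr !big_split /= !sumrN !sum_dot0 (frame_polarization frameA).
  by rewrite sumr_const card_ord; ring.
have /andP[dot_ge dot_le] := dotprod_unit_bounds x_unit y_unit.
(* Replacing [N%:R] by [A * M%:R] turns the two bounds into [4 * (A * M%:R - A)] and
   [4 * (A * M%:R + A)]. *)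
rewrite -(unit_norm_frame_constant frameA phi_unit).
have -> : 4 * (A * M%:R) * (1 - 1 / M%:R) = 4 * (A * M%:R - A) by field.
have -> : 4 * (A * M%:R) * (1 + 1 / M%:R) = 4 * (A * M%:R + A) by field.
(* The gaps to the lower and upper bounds are [4 * A * (1 + dotprod x y)] and
   [4 * A * (1 - dotprod x y)], products of nonnegative factors. *)
by apply/andP; split; nra.
Qed.
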